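(* Let $\phi:\mathbb{R}^n\to\mathbb{R}$ be continuously differentiable with $L$-Lipschitz continuous gradient ($L>0$), and let $f:\mathbb{R}^n\to\mathbb{R}$ satisfy $|f(x)-\phi(x)|\le\epsilon_f$ for all $x\in\mathbb{R}^n$, where $\epsilon_f\ge 0$ is a constant. Let $\theta\in[0,\tfrac12)$, $c_1\in(0,1)$, $\tau\in(0,1)$, and suppose that $$\bar\alpha=\frac{2\left(1-2\theta-c_1(1-\theta)\right)}{L(1-\theta)}>0 .$$ Assume that $\phi$ is bounded below by a scalar $\hat\phi$. Let $\{x_k\}$ be generated from some $x_0\in\mathbb{R}^n$ by $x_{k+1}=x_k-\alpha_k g(x_k)$, where $g(x_k)\in\mathbb{R}^n$ satisfies $\|g(x_k)-\nabla\phi(x_k)\|\le\theta\|\nabla\phi(x_k)\|$ for all $k$, and where $\alpha_k>0$ is obtained by the backtracking line search described in the context and so satisfies the relaxed Armijo condition $$f(x_k-\alpha_k g(x_k))\le f(x_k)-c_1\alpha_k\|g(x_k)\|^2+2\epsilon_f .$$ Then, for any integer $T\ge1$, $$\frac1T\sum_{k=0}^{T-1}\|\nabla\phi(x_k)\|^2\le\frac{\phi(x_0)-\hat\phi}{\eta T}+\frac{4\epsilon_f}{\eta},$$ where $\eta=c_1\tau\bar\alpha(1-\theta)^2$, and the right-hand side converges to $\frac{4\epsilon_f}{\eta}$ as $T\to\infty$.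
   Context: $\|\cdot\|$ is the Euclidean norm. Backtracking line search: at iteration $k$ an initial trial value of the step size, which is at least $\tau\bar\alpha$, is chosen; as long as the current trial value $\alpha$ does not satisfy the relaxed Armijo condition $f(x_k-\alpha g(x_k))\le f(x_k)-c_1\alpha\|g(x_k)\|^2+2\epsilon_f$, it is replaced by $\tau\alpha$; $\alpha_k$ is the first trial value that satisfies the condition. *)

(* Defs.v *)
From HB Require Import structures.
From mathcomp Require Import all_boot all_order all_algebra.
From mathcomp Require Import all_classical all_reals all_analysis.
Import Order.TTheory GRing.Theory Num.Theory.
Import numFieldNormedType.Exports.

Set Implicit Arguments.
Unset Strict Implicit.
Unset Printing Implicit Defensive.

Local Open Scope classical_set_scope.
Local Open Scope ring_scope.

(* The library norm `|v| on 'rV[R]_n is the sup norm, hence this definition.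
   Both norms induce the same topology, so the library's differentiability and
   continuity on 'rV[R]_n are the Euclidean ones. *)
Definition enorm (R : realType) (n : nat) (v : 'rV[R]_n) : R :=
  Num.sqrt (\sum_(i < n) v ord0 i ^+ 2).

Definition gradient (R : realType) (n : nat) (phi : 'rV[R]_n -> R)
    (x : 'rV[R]_n) : 'rV[R]_n :=
  \row_(i < n) 'D_(delta_mx ord0 i) phi x.

Definition continuously_differentiable (R : realType) (n : nat)
    (phi : 'rV[R]_n -> R) : Prop :=
  (forall x, differentiable phi x) /\ continuous (gradient phi).

Definition relaxed_armijo (R : realType) (n : nat) (f : 'rV[R]_n -> R)
    (c1 eps_f : R) (x d : 'rV[R]_n) (a : R) : Prop :=
  f (x - a *: d) <= f x - c1 * a * enorm d ^+ 2 + 2 * eps_f.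

(* [backtracks tau accept a0 a]: starting from the trial value a0, the line
   search with reduction factor tau terminates and returns a. *)
Inductive backtracks (R : realType) (tau : R) (accept : R -> Prop) :
    R -> R -> Prop :=
| backtracks_stop (a : R) : accept a -> backtracks tau accept a a
| backtracks_shrink (a b : R) :
    ~ accept a -> backtracks tau accept (tau * a) b -> backtracks tau accept a b.

(* Main.v *)
Require Import Defs.
From HB Require Import structures.
From mathcomp Require Import all_boot all_order all_algebra.
From mathcomp Require Import all_classical all_reals all_analysis.
From mathcomp Require Import ring lra.
Import Order.TTheory GRing.Theory Num.Theory.
Import numFieldNormedType.Exports.

Local Open Scope classical_set_scope.
Local Open Scope ring_scope.

(** Every accepted step decreases the true function [phi] by a fixed multiple
    of the squared gradient norm, up to the noise [4 * eps_f]; summing these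
    decreases along the iterates telescopes, and [phi] is bounded below.

    The decrease needs a lower bound on the accepted step sizes.  A Lipschitz
    gradient puts [phi] below a quadratic model at each point
    ([le_quadratic_model]), and a direction [g] with relative error [theta] is
    still an ascent direction in a quantitative sense ([dot_approx_ge]).
    Together they show that every trial step in the interval from [0] to
    [alphabar] satisfies Armijo's condition for [phi] exactly; replacing [phi]
    by [f] costs [eps_f] at each of the two evaluations, which is what the
    relaxation [2 * eps_f] absorbs ([short_step_accepted]).  Hence a rejected
    trial step exceeds [alphabar], and the trial step after it, being [tau]
    times a rejected one, is at least [tau * alphabar] ([backtracks_ge]).

    Passing from [f] back to [phi] in the accepted inequality costs another
    [2 * eps_f], and [enorm g >= (1 - theta) * enorm (gradient phi)] turns the
    decrease into [eta] times the squared gradient norm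
    ([accepted_step_decrease]). *)

(** * Euclidean inner product *)

Definition dot {R : realType} {n : nat} (u v : 'rV[R]_n) : R :=
  \sum_(i < n) u ord0 i * v ord0 i.

Lemma dotDl {R : realType} {n : nat} (u v w : 'rV[R]_n) :
  dot (u + v) w = dot u w + dot v w.
Proof. by rewrite -big_split; apply: eq_bigr => i _; rewrite mxE mulrDl. Qed.

Lemma dotZl {R : realType} {n : nat} (a : R) (u v : 'rV[R]_n) :
  dot (a *: u) v = a * dot u v.
Proof. by rewrite mulr_sumr; apply: eq_bigr => i _; rewrite mxE mulrA. Qed.

Lemma dotC {R : realType} {n : nat} (u v : 'rV[R]_n) : dot u v = dot v u.
Proof. by apply: eq_bigr => i _; rewrite mulrC. Qed.

Lemma dotBl {R : realType} {n : nat} (u v w : 'rV[R]_n) :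
  dot (u - v) w = dot u w - dot v w.
Proof. by rewrite -scaleN1r dotDl dotZl mulN1r. Qed.

Lemma enorm_ge0 {R : realType} {n : nat} (u : 'rV[R]_n) : 0 <= enorm u.
Proof. exact: sqrtr_ge0. Qed.

Lemma enorm_sqr {R : realType} {n : nat} (u : 'rV[R]_n) :
  enorm u ^+ 2 = dot u u.
Proof. by rewrite sqr_sqrtr ?sumr_ge0// => i _; exact: sqr_ge0. Qed.

Lemma enormZ {R : realType} {n : nat} (a : R) (u : 'rV[R]_n) :
  enorm (a *: u) = `|a| * enorm u.
Proof.
apply/eqP; rewrite -(@eqrXn2 _ 2) ?mulr_ge0 ?enorm_ge0//.
by rewrite exprMn real_normK ?num_real// !enorm_sqr dotZl dotC dotZl mulrA.
Qed.

(** Cauchy-Schwarz, from [0 <= enorm w ^+ 2] with [w = dot v v *: u - dot u v *: v],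
    the component of [u] orthogonal to [v] up to a factor.  That factor vanishes
    when [v] does, so the case [v = 0] is separate. *)
Lemma dot_le {R : realType} {n : nat} (u v : 'rV[R]_n) :
  dot u v <= enorm u * enorm v.
Proof.
have [v0|vN0] := eqVneq (enorm v) 0.
  have vE i : v ord0 i = 0.
    have : dot v v == 0 by rewrite -enorm_sqr v0 expr0n.
    rewrite psumr_eq0 => [|j _]; last exact: sqr_ge0.
    by move=> /allP /(_ i (mem_index_enum i)); rewrite mulf_eq0 orbb => /eqP.
  by rewrite v0 mulr0 /dot big1// => i _; rewrite vE mulr0.
have v_gt0 : 0 < dot v v by rewrite -enorm_sqr exprn_gt0 // lt0r vN0 enorm_ge0.
have := sqr_ge0 (enorm (dot v v *: u - dot u v *: v)).
rewrite enorm_sqr dotBl !dotZl !(dotC _ (_ - _)) !dotBl !dotZl (dotC v u).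
set A := dot u u; set B := dot v v; set C := dot u v => h.
have {}h : 0 <= A * B - C ^+ 2.
  rewrite -(pmulr_rge0 _ v_gt0) -/B; by congr (is_true (0 <= _)): h; ring.
apply: le_trans (ler_norm _) _.
rewrite -ler_sqr ?nnegrE ?normr_ge0 ?mulr_ge0 ?enorm_ge0//.
by rewrite real_normK ?num_real// exprMn !enorm_sqr -subr_ge0.
Qed.

(** * The quadratic upper model of a function with Lipschitz gradient *)

Lemma derive_dot_gradient {R : realType} {n : nat} (phi : 'rV[R]_n -> R)
    (z d : 'rV[R]_n) :
  differentiable phi z -> 'D_d phi z = dot (gradient phi z) d.
Proof.
move=> dphi; rewrite deriveE// {1}[d]row_sum_delta linear_sum.
by apply: eq_bigr => i _; rewrite linearZ /= mxE deriveE// mulrC.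
Qed.

Lemma differentiable_is_derive_line {R : realType} {n : nat}
    (phi : 'rV[R]_n -> R) (y d : 'rV[R]_n) (t : R) :
  differentiable phi (y + t *: d) ->
  is_derive t 1 (fun s : R => phi (y + s *: d)) (dot (gradient phi (y + t *: d)) d).
Proof.
move=> dphi.
have dE := derive_dot_gradient phi _ d dphi.
(* Both difference quotients at [t] are the same function of the increment. *)
have quotE : (fun h : R => h^-1 *: (((fun s : R => phi (y + s *: d)) \o shift t)
      (h *: (1 : R)) - phi (y + t *: d))) =
    (fun h : R => h^-1 *: ((phi \o shift (y + t *: d)) (h *: d)
      - phi (y + t *: d))).
  apply/funext => h /=; congr (_ *: (phi _ - _)).
  by rewrite /shift/= [h *: 1](mulr1 h) scalerDl addrCA.
split; last by rewrite -dE /derive quotE.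
by rewrite /derivable quotE; exact: diff_derivable.
Qed.

(** The gap between [phi] and the model along the segment from [y] to [y + d]
    has derivative [dot (gradient phi (y + t *: d) - gradient phi y) d
    - L * t * enorm d ^+ 2], which is nonpositive for [t >= 0] by Cauchy-Schwarz
    and the Lipschitz bound. *)
Lemma le_quadratic_model {R : realType} {n : nat} (phi : 'rV[R]_n -> R) (L : R)
    (dphi : forall z, differentiable phi z)
    (grad_lip : forall y z : 'rV[R]_n,
      enorm (gradient phi y - gradient phi z) <= L * enorm (y - z))
    (y d : 'rV[R]_n) :
  phi (y + d) <= phi y + dot (gradient phi y) d + L / 2 * enorm d ^+ 2.
Proof.
pose c := dot (gradient phi y) d; pose e := L / 2 * enorm d ^+ 2.
pose gap : R -> R := (fun t : R => phi (y + t *: d)) - (c *: id + e *: id ^+ 2).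
have gapV (t : R) : gap t = phi (y + t *: d) - (c * t + e * t ^+ 2) by [].
pose dgap t : R := dot (gradient phi (y + t *: d)) d
  - (c *: 1 + e *: ((2%:R * t ^+ 1) *: 1)).
have gap_derive (t : R) : is_derive t 1 gap (dgap t).
  by have dline := differentiable_is_derive_line _ _ _ _ (dphi (y + t *: d)); exact: is_deriveB.
have [|t /[!in_itv]/= /andP[t_gt0 _]] := @MVT R gap dgap 0 1 ltr01 (fun t _ => gap_derive t).
  by apply: derivable_within_continuous => t _; exact: ex_derive.
rewrite subr0 mulr1 => gapE.
have dgap_le0 : dgap t <= 0.
  have := le_trans (dot_le (gradient phi (y + t *: d) - gradient phi y) d)
    (ler_wpM2r (enorm_ge0 d) (grad_lip (y + t *: d) y)).
  rewrite dotBl addrAC subrr add0r enormZ (gtr0_norm t_gt0).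
  rewrite /dgap /e -/c /GRing.scale/=; lra.
move: gapE dgap_le0 => <-.
rewrite !gapV scale1r scale0r addr0 -/c /e; lra.
Qed.

(** * Backtracking with an approximate gradient *)

(** The reverse triangle inequality, in the form that bounds a vector by an
    approximation with relative error [theta]. *)
Lemma enorm_approx_ge {R : realType} {n : nat} (theta : R) (g p : 'rV[R]_n) :
  enorm (g - p) <= theta * enorm p -> (1 - theta) * enorm p <= enorm g.
Proof.
move=> gp; have [p0|pN0] := eqVneq (enorm p) 0.
  by rewrite p0 mulr0 enorm_ge0.
have p_gt0 : 0 < enorm p by rewrite lt0r pN0 enorm_ge0.
have gp_le := dot_le (p - g) p.
have g_le := dot_le g p.
have pgE : enorm (p - g) = enorm (g - p).
  by rewrite -opprB -scaleN1r enormZ normrN normr1 mul1r.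
rewrite pgE dotBl -enorm_sqr in gp_le.
have := ler_wpM2r (ltW p_gt0) gp => h.
rewrite -(ler_pM2r p_gt0); lra.
Qed.

Lemma dot_approx_ge {R : realType} {n : nat} (theta : R) (g p : 'rV[R]_n)
    (theta_ge0 : 0 <= theta) (theta_lt1 : theta < 1) :
  enorm (g - p) <= theta * enorm p ->
  (1 - 2 * theta) * enorm g ^+ 2 <= (1 - theta) * dot p g.
Proof.
move=> gp; have pg := enorm_approx_ge _ _ _ gp.
(* The error is at most [theta / (1 - theta)] relative to [g] itself. *)
have err : (1 - theta) * enorm (g - p) <= theta * enorm g.
  have h1 : (1 - theta) * enorm (g - p) <= (1 - theta) * (theta * enorm p).
    by rewrite ler_wpM2l// subr_ge0 ltW.
  have h2 : theta * ((1 - theta) * enorm p) <= theta * enorm g.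
    by rewrite ler_wpM2l.
  lra.
have gp_le := dot_le (g - p) g; rewrite dotBl -enorm_sqr in gp_le.
have h3 : (1 - theta) * (enorm g ^+ 2 - dot p g) <=
    (1 - theta) * (enorm (g - p) * enorm g) by rewrite ler_wpM2l// subr_ge0 ltW.
have := ler_wpM2r (enorm_ge0 g) err.
lra.
Qed.

(** The assumption on [a] says that the slope [(1 - 2 * theta) / (1 - theta)]
    of [dot_approx_ge], less the curvature term [L * a / 2] of the quadratic
    model, is at least [c1]. *)
Lemma short_step_accepted {R : realType} {n : nat} (phi f : 'rV[R]_n -> R)
    (L eps_f theta c1 a : R) (y g : 'rV[R]_n)
    (dphi : forall z, differentiable phi z)
    (grad_lip : forall y z : 'rV[R]_n,
      enorm (gradient phi y - gradient phi z) <= L * enorm (y - z))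
    (f_phi : forall z : 'rV[R]_n, `|f z - phi z| <= eps_f)
    (theta_ge0 : 0 <= theta) (theta_lt1 : theta < 1)
    (g_approx : enorm (g - gradient phi y) <= theta * enorm (gradient phi y))
    (a_ge0 : 0 <= a)
    (a_le : a * (L * (1 - theta)) <= 2 * (1 - 2 * theta - c1 * (1 - theta))) :
  relaxed_armijo f c1 eps_f y g a.
Proof.
have model := le_quadratic_model phi L dphi grad_lip y (- a *: g).
rewrite dotC dotZl dotC enormZ normrN ger0_norm// exprMn scaleNr in model.
have slope := dot_approx_ge theta g _ theta_ge0 theta_lt1 g_approx.
have exact_armijo : phi (y - a *: g) <= phi y - c1 * a * enorm g ^+ 2.
  apply: le_trans model _.
  have theta1 : 0 < 1 - theta by rewrite subr_gt0.
  rewrite -(ler_pM2l theta1).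
  have h1 := ler_wpM2l a_ge0 slope.
  have h2 := ler_wpM2l (mulr_ge0 a_ge0 (sqr_ge0 (enorm g))) a_le.
  lra.
have := f_phi (y - a *: g); rewrite ler_norml => /andP[_ f_ub].
have := f_phi y; rewrite ler_norml => /andP[f_lb _].
rewrite /relaxed_armijo; lra.
Qed.

(** The search stops at once, or shrinks a rejected trial value; a rejected
    value exceeds [abar], so [tau] times it still exceeds [tau * abar], and that
    bound is an invariant of the search. *)
Lemma backtracks_ge {R : realType} (tau abar a0 a : R) (accept : R -> Prop)
    (tau_gt0 : 0 < tau) (abar_gt0 : 0 < abar)
    (short_accept : forall b, 0 < b -> b <= abar -> accept b) :
  backtracks tau accept a0 a -> tau * abar <= a0 -> tau * abar <= a.
Proof.
elim=> // {}a0 b rejected _ IH a0_ge; apply: IH; rewrite ler_pM2l//.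
have a0_gt0 : 0 < a0 by apply: lt_le_trans a0_ge; rewrite mulr_gt0.
by rewrite leNgt; apply/negP => /ltW /(short_accept _ a0_gt0) /rejected.
Qed.

Lemma backtracks_accept {R : realType} (tau a0 a : R) (accept : R -> Prop) :
  backtracks tau accept a0 a -> accept a.
Proof. by elim. Qed.

(** Armijo's condition bounds the decrease of [f] by the step size and by
    [enorm g]; the true gradient [p] enters through [enorm_approx_ge], and each
    end point costs [eps_f] more when [phi] replaces [f]. *)
Lemma accepted_step_decrease {R : realType} {n : nat} (phi f : 'rV[R]_n -> R)
    (eps_f theta c1 amin a : R) (y g p : 'rV[R]_n)
    (f_phi : forall z : 'rV[R]_n, `|f z - phi z| <= eps_f)
    (theta_le1 : theta <= 1) (c1_ge0 : 0 <= c1)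
    (g_approx : enorm (g - p) <= theta * enorm p)
    (amin_ge0 : 0 <= amin) (amin_le : amin <= a) :
  relaxed_armijo f c1 eps_f y g a ->
  c1 * amin * (1 - theta) ^+ 2 * enorm p ^+ 2
    <= phi y - phi (y - a *: g) + 4 * eps_f.
Proof.
rewrite /relaxed_armijo => armijo.
have := f_phi (y - a *: g); rewrite ler_norml => /andP[f_lb _].
have := f_phi y; rewrite ler_norml => /andP[_ f_ub].
have decrease : c1 * amin * (1 - theta) ^+ 2 * enorm p ^+ 2
    <= c1 * a * enorm g ^+ 2.
  rewrite -mulrA -exprMn; apply: ler_pM; rewrite ?sqr_ge0 ?mulr_ge0//.
    by rewrite ler_wpM2l.
  have pg := enorm_approx_ge _ _ _ g_approx.
  by rewrite ler_sqr ?nnegrE ?mulr_ge0 ?enorm_ge0 ?subr_ge0.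
lra.
Qed.

(** * Averaging the decreases *)

Theorem theorem2p11 (R : realType) (n : nat)
  (phi f : 'rV[R]_n -> R) (L eps_f theta c1 tau alphabar eta phihat : R)
  (g : 'rV[R]_n -> 'rV[R]_n) (x : nat -> 'rV[R]_n) (alpha0 alpha : nat -> R)
  (L_gt0 : 0 < L)
  (phi_C1 : continuously_differentiable phi)
  (grad_lip : forall y z : 'rV[R]_n,
     enorm (gradient phi y - gradient phi z) <= L * enorm (y - z))
  (eps_f_ge0 : 0 <= eps_f)
  (f_phi : forall y : 'rV[R]_n, `|f y - phi y| <= eps_f)
  (theta_ge0 : 0 <= theta) (theta_lt : theta < 1 / 2)
  (c1_gt0 : 0 < c1) (c1_lt1 : c1 < 1)
  (tau_gt0 : 0 < tau) (tau_lt1 : tau < 1)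
  (alphabarE : alphabar =
     2 * (1 - 2 * theta - c1 * (1 - theta)) / (L * (1 - theta)))
  (alphabar_gt0 : 0 < alphabar)
  (phi_ge : forall y : 'rV[R]_n, phihat <= phi y)
  (xS : forall k : nat, x k.+1 = x k - alpha k *: g (x k))
  (g_approx : forall k : nat,
     enorm (g (x k) - gradient phi (x k)) <= theta * enorm (gradient phi (x k)))
  (alpha_gt0 : forall k : nat, 0 < alpha k)
  (alpha0_ge : forall k : nat, tau * alphabar <= alpha0 k)
  (line_search : forall k : nat,
     backtracks tau (relaxed_armijo f c1 eps_f (x k) (g (x k)))
       (alpha0 k) (alpha k))
  (etaE : eta = c1 * tau * alphabar * (1 - theta) ^+ 2) :
  (forall T : nat, (1 <= T)%N ->
     1 / T%:R * (\sum_(0 <= k < T) enorm (gradient phi (x k)) ^+ 2)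
       <= (phi (x 0%N) - phihat) / (eta * T%:R) + 4 * eps_f / eta) /\
  (fun T : nat => (phi (x 0%N) - phihat) / (eta * T%:R) + 4 * eps_f / eta)
    @ \oo --> 4 * eps_f / eta.
Proof.
have theta1 : 0 < 1 - theta by lra.
have eta_gt0 : 0 < eta by rewrite etaE !mulr_gt0// exprn_gt0.
have [dphi _] := phi_C1.
have short k a : 0 < a -> a <= alphabar ->
    relaxed_armijo f c1 eps_f (x k) (g (x k)) a.
  move=> a_gt0 a_le; apply: (short_step_accepted phi f L eps_f theta) => //.
  - by lra.
  - exact: ltW.
  - by rewrite -ler_pdivlMr ?mulr_gt0// -alphabarE.
have step k : eta * enorm (gradient phi (x k)) ^+ 2
    <= phi (x k) - phi (x k.+1) + 4 * eps_f.
  rewrite xS etaE -[c1 * tau * alphabar]mulrA.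
  apply: accepted_step_decrease (backtracks_accept _ _ _ _ (line_search k)) => //.
  - by lra.
  - exact: ltW.
  - by rewrite ltW// mulr_gt0.
  - exact: backtracks_ge (short k) (line_search k) (alpha0_ge k).
split=> [T T_ge1|].
  have T_gt0 : 0 < T%:R :> R by rewrite ltr0n.
  have total : eta * \sum_(0 <= k < T) enorm (gradient phi (x k)) ^+ 2
      <= phi (x 0%N) - phihat + 4 * eps_f * T%:R.
    rewrite mulr_sumr; apply: le_trans (ler_sum_nat (fun k _ => step k)) _.
    rewrite big_split /= sumr_const_nat subn0 mulr_natr lerD2r.
    rewrite -(opprK (\sum_(0 <= k < T) _)) -sumrN.
    under eq_bigr do rewrite opprB.
    by rewrite telescope_sumr// opprB lerD2l lerN2.
  rewrite -(ler_pM2l (mulr_gt0 eta_gt0 T_gt0)).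
  have -> : eta * T%:R * (1 / T%:R *
      \sum_(0 <= k < T) enorm (gradient phi (x k)) ^+ 2) =
      eta * \sum_(0 <= k < T) enorm (gradient phi (x k)) ^+ 2.
    by field; rewrite gt_eqF.
  apply: le_trans total _; rewrite le_eqVlt; apply/orP; left; apply/eqP.
  by field; rewrite !gt_eqF.
have vanish : (fun T : nat => (phi (x 0%N) - phihat) / (eta * T%:R)) @ \oo
    --> (0 : R).
  rewrite -cvg_shiftS.
  have -> : [sequence (phi (x 0%N) - phihat) / (eta * T.+1%:R)]_T =
      (fun T => (phi (x 0%N) - phihat) / eta * harmonic T).
    by apply/funext => T; rewrite /= invfM mulrA.
  have := cvgMl_tmp (a := (phi (x 0%N) - phihat) / eta) (@cvg_harmonic R).
  by rewrite mulr0; exact.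
have := cvgD vanish (cvg_cst (4 * eps_f / eta)).
by rewrite add0r; exact.
Qed.
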